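(* Let $n\ge 1$ and let $\mathbb{F}_q$ be a finite field. For every coadjoint template $\tau\in\mathcal{T}^*(n,\mathbb{F}_q)$, $$\chi(\tau)=\prod_{1\le i<j\le n}\chi(\tau(e_{ij})\cdot\varepsilon_{ij}),$$ where the product is the (pointwise) product of characters, i.e. the character of the tensor product.
   Context: $U(n,\mathbb{F}_q)$ is the group of upper triangular unipotent $n\times n$ matrices over $\mathbb{F}_q$, $\mathfrak{u}(n,\mathbb{F}_q)$ is the algebra of upper triangular nilpotent (strictly upper triangular) matrices, with basis the matrix units $e_{ij}$ ($1\le i<j\le n$), and $\mathfrak{u}^*(n,\mathbb{F}_q)$ is its $\mathbb{F}_q$-linear dual with dual basis $\varepsilon_{ij}$ (so $\varepsilon_{ij}(X)=x_{ij}$). For $\lambda\in\mathfrak{u}^*(n,\mathbb{F}_q)$, $\mathrm{supp}(\lambda)$ is the set of positions $(i,j)$ with $\lambda(e_{ij})\ne 0$. $\mathcal{T}^*(n,\mathbb{F}_q)$ is the set of coadjoint templates: those $\tau\in\mathfrak{u}^*(n,\mathbb{F}_q)$ whose support contains at most one position in each row and each column. For $g\in U(n,\mathbb{F}_q)$ and $\lambda\in\mathfrak{u}^*(n,\mathbb{F}_q)$ define $(g*\lambda)(X)=\lambda(Xg)$ (left action). Fix a non-trivial homomorphism $\theta$ from the additive group of $\mathbb{F}_q$ to the multiplicative group $\mathbb{C}^\times$. Let $\mathbb{C}[U(n,\mathbb{F}_q)]$ be the space of complex-valued functions on $U(n,\mathbb{F}_q)$, carrying the regular representation $(g*v)(g')=v(g'g)$,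 and put $v(\lambda)(g)=\theta[\lambda(g-I)]$. For $\lambda\in\mathfrak{u}^*(n,\mathbb{F}_q)$, the span $V(\lambda)$ of $\{v(\mu): \mu=g*\lambda,\ g\in U(n,\mathbb{F}_q)\}$ is a submodule of the regular representation, called a cluster module; its character $\chi(\lambda)$ is called a cluster character. In particular $\chi(0)$ is the trivial character. *)

(* Defs.v *)
From HB Require Import structures.
From mathcomp Require Import all_boot all_order all_algebra all_fingroup.
From mathcomp Require Import mxrepresentation reals complex.

Set Implicit Arguments.
Unset Strict Implicit.
Unset Printing Implicit Defensive.

Import Order.TTheory GRing.Theory Num.Theory.
Local Open Scope ring_scope.

Definition unitriangular (F : finFieldType) (n : nat) : pred 'M[F]_n :=
  fun A => [forall i : 'I_n, forall j : 'I_n,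
    ((j < i)%N ==> (A i j == 0)) && ((i == j) ==> (A i j == 1))].
Arguments unitriangular {F n}.

Lemma unitriangularP (F : finFieldType) (n : nat) (A : 'M[F]_n) :
  reflect ((forall i j : 'I_n, (j < i)%N -> A i j = 0) /\ (forall i, A i i = 1))
          (unitriangular A).
Proof.
apply: (iffP idP) => [/forallP H | [H0 H1]].
  split=> [i j ji|i]; first by have /forallP/(_ j)/andP[/implyP/(_ ji)/eqP] := H i.
  by have /forallP/(_ i)/andP[_ /implyP/(_ (eqxx i))/eqP] := H i.
apply/forallP => i; apply/forallP => j; apply/andP.
by split; apply/implyP; [move=> ji|move=> /eqP<-]; apply/eqP; auto.
Qed.

Record unitri (F : finFieldType) (n : nat) := UniTri {
  umx :> 'M[F]_n;
  umxP : unitriangular umx }.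

HB.instance Definition _ (F : finFieldType) (n : nat) :=
  [isSub for @umx F n].
HB.instance Definition _ (F : finFieldType) (n : nat) :=
  [Finite of unitri F n by <:].

Section UnitriGroup.
Variables (F : finFieldType) (n : nat).
Implicit Types A B : 'M[F]_n.

Fact unitriangular1 : unitriangular (1%:M : 'M[F]_n).
Proof.
apply/unitriangularP; split=> [i j ji|i]; rewrite mxE ?eqxx //.
by have -> : (i == j) = false by apply/eqP=> ij; rewrite ij ltnn in ji.
Qed.

Fact unitriangularM A B :
  unitriangular A -> unitriangular B -> unitriangular (A *m B).
Proof.
move=> /unitriangularP[A0 A1] /unitriangularP[B0 B1].
apply/unitriangularP; split=> [i j ji|i]; rewrite mxE.
  apply: big1 => k _; case: (ltnP k i) => [ki|ik]; first by rewrite A0 ?mul0r.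
  by rewrite B0 ?mulr0 // (leq_trans ji).
rewrite (bigD1 i) //= A1 B1 mulr1 big1 ?addr0 // => k ki.
case: (ltngtP k i) => [lt|lt|/val_inj e]; first by rewrite A0 ?mul0r.
  by rewrite B0 ?mulr0.
by rewrite e eqxx in ki.
Qed.

Fact unitriangular_unit A : unitriangular A -> A \in unitmx.
Proof.
move=> /unitriangularP[A0 A1].
have -> : A = (A^T)^T by rewrite trmxK.
rewrite unitmx_tr unitmxE det_trig; last first.
  by apply/is_trig_mxP => i j ij; rewrite mxE A0.
by rewrite big1 ?unitr1 // => i _; rewrite mxE A1.
Qed.

Definition unitri_one : unitri F n := UniTri unitriangular1.
Definition unitri_mul (g h : unitri F n) : unitri F n :=
  UniTri (unitriangularM (umxP g) (umxP h)).

Fact unitriangularV A : unitriangular A -> unitriangular (invmx A).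
Proof.
move=> uA; pose g := UniTri uA.
have inj_g : injective (unitri_mul g).
  move=> x y /(congr1 val) /= e; apply: val_inj => /=.
  by rewrite -[LHS](mulKmx (unitriangular_unit uA)) e
             mulKmx ?unitriangular_unit.
have [h _ gK] := injF_bij inj_g.
have := congr1 val (gK unitri_one) => /= e.
by rewrite -[invmx A]mulmx1 -e mulKmx ?umxP ?unitriangular_unit.
Qed.

Definition unitri_inv (g : unitri F n) : unitri F n :=
  UniTri (unitriangularV (umxP g)).

Fact unitri_mulA : associative unitri_mul.
Proof. by move=> x y z; apply: val_inj; rewrite /= mulmxA. Qed.

Fact unitri_mul1 : left_id unitri_one unitri_mul.
Proof. by move=> x; apply: val_inj; rewrite /= mul1mx. Qed.

Fact unitri_mulV : left_inverse unitri_one unitri_inv unitri_mul.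
Proof.
by move=> x; apply: val_inj; rewrite /= mulVmx ?unitriangular_unit ?umxP.
Qed.

HB.instance Definition _ :=
  Finite_isGroup.Build (unitri F n) unitri_mulA unitri_mul1 unitri_mulV.

Lemma umxM (g h : unitri F n) : umx (g * h)%g = umx g *m umx h.
Proof. by []. Qed.

Lemma umx1 : umx (1%g : unitri F n) = 1%:M.
Proof. by []. Qed.

End UnitriGroup.

Definition nilvs (F : finFieldType) (n : nat) : {vspace 'M[F]_n} :=
  (\sum_(p : 'I_n * 'I_n | (p.1 < p.2)%N) <[delta_mx p.1 p.2]>)%VS.

Definition nilalg (F : finFieldType) (n : nat) := subvs_of (nilvs F n).

Definition nilalg_dual (F : finFieldType) (n : nat) := 'Hom(nilalg F n, F^o).

Section Dual.
Variables (F : finFieldType) (n : nat).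

Lemma nilvsP (X : 'M[F]_n) :
  reflect (forall i j : 'I_n, (j <= i)%N -> X i j = 0) (X \in nilvs F n).
Proof.
apply: (iffP idP) => [/memv_sumP[Y YP ->] i j ji|X0].
  rewrite summxE big1 // => -[a b] /= ab.
  have /vlineP[k ->] := YP (a, b) ab; rewrite !mxE /=.
  case: eqP => [ia|_]; last by rewrite mulr0.
  case: eqP => [jb|_]; last by rewrite mulr0.
  by move: ab; rewrite -ia -jb ltnNge ji.
rewrite [X]matrix_sum_delta; apply: rpred_sum => i _; apply: rpred_sum => j _.
case: (leqP j i) => [ji|ij]; first by rewrite X0 // scale0r rpred0.
apply: rpredZ; apply: (subvP (sumv_sup (i, j) ij (subvv _))).
exact: memv_line.
Qed.

(* [vsproj] is the identity on [nilvs F n], which contains the arguments below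
   ([val_nil_unit], [val_nil_mulr], [val_nil_sub1]), except for [nil_unit i j]
   with [j <= i], which is meaningless. *)
Definition nil_unit (i j : 'I_n) : nilalg F n := vsproj _ (delta_mx i j).

Definition nil_mulr (X : nilalg F n) (g : unitri F n) : nilalg F n :=
  vsproj _ (vsval X *m umx g).

Definition nil_sub1 (g : unitri F n) : nilalg F n := vsproj _ (umx g - 1%:M).

Lemma val_nil_unit (i j : 'I_n) :
  (i < j)%N -> vsval (nil_unit i j) = delta_mx i j.
Proof.
move=> ij; apply: vsprojK; apply/nilvsP => a b ba; rewrite mxE.
case: eqP => [ai|//]; case: eqP => [bj|//].
by move: ij; rewrite -ai -bj ltnNge ba.
Qed.

Lemma val_nil_mulr X g : vsval (nil_mulr X g) = vsval X *m umx g.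
Proof.
apply: vsprojK; apply/nilvsP => i j ji; rewrite mxE; apply: big1 => k _.
have /nilvsP X0 := subvsP X; have /unitriangularP[g0 _] := umxP g.
case: (leqP k i) => [ki|ik]; first by rewrite X0 ?mul0r.
by rewrite g0 ?mulr0 // (leq_ltn_trans ji).
Qed.

Lemma val_nil_sub1 g : vsval (nil_sub1 g) = umx g - 1%:M.
Proof.
apply: vsprojK; apply/nilvsP => i j ji; rewrite !mxE.
have /unitriangularP[g0 g1] := umxP g.
case: eqP => [->|ij]; first by rewrite g1 subrr.
rewrite g0 ?subr0 // ltn_neqAle ji andbT.
by apply/eqP => e; apply: ij; apply: val_inj.
Qed.

Definition nil_entry (i j : 'I_n) (X : nilalg F n) : F^o := vsval X i j.

Fact nil_entry_is_linear i j : linear (nil_entry i j).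
Proof. by move=> a X Y; rewrite /nil_entry linearP /= !mxE. Qed.
HB.instance Definition _ i j :=
  GRing.isLinear.Build F (nilalg F n) F^o _ (nil_entry i j)
    (nil_entry_is_linear i j).

Definition dual_unit (i j : 'I_n) : nilalg_dual F n := linfun (nil_entry i j).

Lemma dual_unitE i j X : dual_unit i j X = vsval X i j.
Proof. exact: lfunE. Qed.

Definition coact_fun (g : unitri F n) (l : nilalg_dual F n) (X : nilalg F n) : F^o :=
  l (nil_mulr X g).

Fact coact_fun_is_linear g l : linear (coact_fun g l).
Proof.
by move=> a X Y; rewrite /coact_fun /nil_mulr linearP /= mulmxDl -scalemxAl
                         !linearP.
Qed.
HB.instance Definition _ g l :=
  GRing.isLinear.Build F (nilalg F n) F^o _ (coact_fun g l)
    (coact_fun_is_linear g l).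

Definition coact (g : unitri F n) (l : nilalg_dual F n) : nilalg_dual F n :=
  linfun (coact_fun g l).

Lemma coactE g l X : coact g l X = l (nil_mulr X g).
Proof. exact: lfunE. Qed.

Lemma coactM g h l : coact (g * h)%g l = coact g (coact h l).
Proof.
apply/lfunP => X; rewrite !coactE; congr (l _); apply: val_inj => /=.
by rewrite !val_nil_mulr umxM mulmxA.
Qed.

Lemma coact1 l : coact 1%g l = l.
Proof.
apply/lfunP => X; rewrite coactE; congr (l _); apply: val_inj => /=.
by rewrite val_nil_mulr umx1 mulmx1.
Qed.

Definition supp (l : nilalg_dual F n) : {set 'I_n * 'I_n} :=
  [set p : 'I_n * 'I_n | (p.1 < p.2)%N && (l (nil_unit p.1 p.2) != 0)].

Definition coadjoint_template (l : nilalg_dual F n) : Prop :=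
  (forall i : 'I_n, (#|[set p in supp l | p.1 == i]| <= 1)%N) /\
  (forall j : 'I_n, (#|[set p in supp l | p.2 == j]| <= 1)%N).

End Dual.

(* Homomorphisms from the additive group of F to the multiplicative group of
   C; that 0 is sent to 1 is automatic ([addchar1]). *)
Record addchar (F : finFieldType) (C : fieldType) := AddChar {
  addchar_fun :> F -> C;
  addchar_neq0 : forall a, addchar_fun a != 0;
  addcharD : {morph addchar_fun : a b / a + b >-> a * b} }.

Lemma addchar1 (F : finFieldType) (C : fieldType) (theta : addchar F C) :
  theta 0 = 1.
Proof.
apply: (mulfI (addchar_neq0 theta 0)).
by rewrite -addcharD addr0 mulr1.
Qed.

Definition nontrivial (F : finFieldType) (C : fieldType)
  (theta : addchar F C) : Prop := exists a, theta a != 1.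

Section Cluster.
Variables (F : finFieldType) (C : fieldType) (n : nat).
Variable theta : addchar F C.

Definition fun_space := {ffun unitri F n -> C^o}.

Definition reg_act (g : unitri F n) (v : fun_space) : fun_space :=
  [ffun g' => v (g' * g)%g].

Fact reg_act_is_linear g : linear (reg_act g).
Proof. by move=> a u v; apply/ffunP => x; rewrite !ffunE. Qed.
HB.instance Definition _ g :=
  GRing.isLinear.Build C fun_space fun_space _ (reg_act g)
    (reg_act_is_linear g).

Lemma reg_actM g h v : reg_act (g * h)%g v = reg_act g (reg_act h v).
Proof. by apply/ffunP => x; rewrite !ffunE mulgA. Qed.

Lemma reg_act1 v : reg_act 1%g v = v.
Proof. by apply/ffunP => x; rewrite !ffunE mulg1. Qed.

Definition cluster_vec (l : nilalg_dual F n) : fun_space :=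
  [ffun g => theta (l (nil_sub1 g))].

Definition cluster_module (l : nilalg_dual F n) : {vspace fun_space} :=
  <<[seq cluster_vec (coact g l) | g : unitri F n]>>%VS.

Lemma reg_act_vec g l :
  reg_act g (cluster_vec l) =
  theta (l (nil_sub1 g)) *: cluster_vec (coact g l).
Proof.
apply/ffunP => x; rewrite !ffunE coactE.
have -> : nil_sub1 (x * g)%g = nil_mulr (nil_sub1 x) g + nil_sub1 g.
  apply: val_inj => /=.
  rewrite val_nil_sub1 val_nil_mulr !val_nil_sub1 umxM.
  by rewrite mulmxBl mul1mx addrA subrK.
by rewrite linearD addcharD mulrC.
Qed.

Lemma cluster_module_stable g l v :
  v \in cluster_module l -> reg_act g v \in cluster_module l.
Proof.
rewrite /cluster_module; set X := image _ _.
move/(@coord_span _ _ _ (in_tuple X)) => ->.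
rewrite linear_sum; apply: rpred_sum => i _.
rewrite linearZ /=; apply: rpredZ.
have /mapP[h _ ->] : (in_tuple X)`_i \in X by exact: mem_nth.
rewrite reg_act_vec -coactM; apply: rpredZ; apply: memv_span.
exact: image_f.
Qed.

Definition cluster_mx (l : nilalg_dual F n) (g : unitri F n) :
    'M[C]_(\dim (cluster_module l)) :=
  \matrix_(i, j) coord (vbasis (cluster_module l)) i
                       (reg_act g (vbasis (cluster_module l))`_j).

Fact cluster_mx_repr l : mx_repr [set: unitri F n] (cluster_mx l).
Proof.
set V := cluster_module l; have fV := basis_free (vbasisP V).
have bV j : (j < \dim V)%N -> (vbasis V)`_j \in V.
  by move=> jV; apply: vbasis_mem; rewrite mem_nth // size_tuple.
split=> [|g h _ _]; apply/matrixP => i j; rewrite !mxE.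
  by rewrite reg_act1 coord_free // eq_sym.
have hV : reg_act h (vbasis V)`_j \in V by apply: cluster_module_stable; exact: bV.
rewrite reg_actM {1}(coord_vbasis hV) linear_sum linear_sum.
by apply: eq_bigr => k _; rewrite !mxE !linearZ /= mulrC.
Qed.

(* The matrix of [reg_act g] on column coordinates, hence a homomorphism. *)
Definition cluster_repr l := MxRepresentation (cluster_mx_repr l).

Definition cluster_char (l : nilalg_dual F n) (g : unitri F n) : C :=
  \tr (cluster_repr l g).

End Cluster.

(* Main.v *)
Require Import Defs.
From mathcomp Require Import all_boot all_order all_algebra all_fingroup.
From mathcomp Require Import mxrepresentation reals complex.

Set Implicit Arguments.
Unset Strict Implicit.
Unset Printing Implicit Defensive.

Import GRing.Theory.
Local Open Scope ring_scope.
Local Open Scope complex_scope.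

(** The functions v(mu), for mu in the orbit of lambda, form a basis of the
    cluster module V(lambda): they are, up to the translation by the identity
    matrix, distinct characters of the additive group of strictly upper
    triangular matrices ([cluster_vec_free]).  Every g permutes this basis up
    to scalars, g v(mu) = theta(mu(g - 1)) v(g mu), so that its trace is
    the sum of theta(mu(g - 1)) over the points mu of the orbit fixed by g
    ([cluster_charE]).

    In coordinates, lambda is a strictly upper triangular matrix, on which g
    acts by M |-> M g^T followed by the erasure of the entries on and below the
    diagonal.  So g acts on each row separately, and the orbit of a template T
    is easy to describe: left of a nonzero entry of T, and above the diagonal,
    every value occurs, independently at all such positions; elsewhere the
    entries are those of T ([coorbit_template]).  Independence holds because
    distinct nonzero entries of T lie in distinct columns, so that they involve
    distinct columns of g.

    Since distinct nonzero entries of T also lie in distinct rows, a point of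
    the orbit of T is a family of points, one in the orbit of each one-entry
    part of T: the family is found by cutting the matrix into rows
    ([row_split]), the point is found by addition ([coorbit_sum]).  The
    bijection commutes with g, hence matches the points fixed by g with the
    families of fixed points, and theta turns the sum of the family into a
    product.  Distributing the product of the character sums over the one-entry
    parts therefore gives the character sum of T. *)

(** * Traces in an arbitrary basis *)

(** The matrices defining a cluster character are taken in the basis [vbasis];
    the trace is computed in the basis of the v(mu). *)
Lemma trace_basis_indep (K : fieldType) (vT : vectType K) (V : {vspace vT})
    (m n : nat) (X : m.-tuple vT) (Y : n.-tuple vT) (f : {linear vT -> vT}) :
  basis_of V X -> basis_of V Y -> {in V, forall v, f v \in V} ->
  \sum_(i < m) coord X i (f X`_i) = \sum_(j < n) coord Y j (f Y`_j).
Proof.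
move=> bX bY fV.
have XV (i : 'I_m) : X`_i \in V by apply: (basis_mem bX); rewrite mem_nth ?size_tuple.
have YV (j : 'I_n) : Y`_j \in V by apply: (basis_mem bY); rewrite mem_nth ?size_tuple.
under eq_bigr => i _ do rewrite [in f _](coord_basis bY (XV i)) !linear_sum /=.
rewrite exchange_big /=; apply: eq_bigr => j _.
rewrite [in RHS](coord_basis bX (fV _ (YV j))) linear_sum /=.
by apply: eq_bigr => i _; rewrite !linearZ /= mulrC.
Qed.

(** * Cluster characters as sums over fixed points *)

Section CharacterFormula.
Variables (F : finFieldType) (C : numFieldType) (n : nat).
Variables (theta : addchar F C).
Hypothesis theta_nt : nontrivial theta.
Implicit Types l m : nilalg_dual F n.

Fact unitriangularD (g : unitri F n) (X : nilalg F n) :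
  unitriangular (umx g + vsval X).
Proof.
have /unitriangularP[g0 g1] := umxP g; have /nilvsP X0 := subvsP X.
apply/unitriangularP; split=> [i j ji|i]; rewrite mxE.
  by rewrite g0 // X0 ?addr0 // ltnW.
by rewrite g1 X0 ?addr0.
Qed.

Definition unitri_shift (X : nilalg F n) (g : unitri F n) : unitri F n :=
  UniTri (unitriangularD g X).

Lemma unitri_shift_inj X : injective (unitri_shift X).
Proof. by move=> g h /(congr1 val) /= /addIr /val_inj. Qed.

Lemma nil_sub1_shift X g : nil_sub1 (unitri_shift X g) = nil_sub1 g + X.
Proof. by apply: val_inj => /=; rewrite !val_nil_sub1 addrAC. Qed.

(** Orthogonality of a nontrivial character with the trivial one: translating
    by an X with theta(l(X)) <> 1 multiplies the sum by that value. *)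
Lemma sum_addchar_eq0 l :
  l != 0 -> \sum_(g : unitri F n) theta (l (nil_sub1 g)) = 0.
Proof.
move=> l_neq0; have [a theta_a] := theta_nt.
have [X lX] : exists X, l X = a.
  have [X lX|l0] := pickP (fun X : 'M[F]_n => l (vsproj _ X) != 0); last first.
    case/eqP: l_neq0; apply/lfunP => X; rewrite lfunE /=.
    by have /negbT := l0 (vsval X); rewrite negbK vsvalK => /eqP.
  by exists ((a / l (vsproj _ X)) *: vsproj _ X); rewrite linearZ; exact: mulfVK.
set S := \sum_g _.
have : S = theta a * S.
  rewrite {1}/S (reindex_inj (@unitri_shift_inj X)) mulr_sumr.
  by apply: eq_bigr => g _; rewrite nil_sub1_shift linearD addcharD /= lX mulrC.
move/eqP; rewrite -subr_eq0 -{1}[S]mul1r -mulrBl mulf_eq0 subr_eq0 eq_sym.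
by rewrite (negPf theta_a) => /eqP.
Qed.

(** The coefficient of v(l) in a linear relation is recovered, up to the order
    of the group, by summing against theta(- l(g - 1)). *)
Lemma cluster_vec_free (s : seq (nilalg_dual F n)) :
  uniq s -> free [seq cluster_vec theta l | l <- s].
Proof.
move=> us; rewrite -[map _ _]/(tval (map_tuple _ (in_tuple s))).
apply/freeP => k k0 i.
pose lk (j : 'I_(size s)) : nilalg_dual F n := s`_j.
have XE (j : 'I_(size s)) :
    (map_tuple (@cluster_vec F C n theta) (in_tuple s))`_j
      = cluster_vec theta (lk j).
  by rewrite /= (nth_map 0).
pose G : C := #|{: unitri F n}|%:R.
have G0 : G != 0.
  by rewrite Num.Theory.pnatr_eq0 -lt0n; apply/card_gt0P; exists 1%g.
have pairing (j : 'I_(size s)) :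
    \sum_(g : unitri F n) theta (- lk i (nil_sub1 g)) * cluster_vec theta (lk j) g
      = (j == i)%:R * G.
  transitivity (\sum_(g : unitri F n) theta ((lk j - lk i) (nil_sub1 g))).
    apply: eq_bigr => g _.
    by rewrite ffunE -addcharD addrC add_lfunE opp_lfunE.
  have [->|ji] := eqVneq j i.
    rewrite subrr mul1r.
    under eq_bigr => g _ do rewrite lfunE /= addchar1.
    by rewrite sumr_const.
  by rewrite mul0r sum_addchar_eq0 // subr_eq0 /lk nth_uniq.
have : \sum_(g : unitri F n) theta (- lk i (nil_sub1 g)) *
   (\sum_(j < size s) k j *: cluster_vec theta (lk j)) g = 0.
  have -> : \sum_(j < size s) k j *: cluster_vec theta (lk j) = 0.
    by rewrite -[RHS]k0; apply: eq_bigr => j _; rewrite XE.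
  by apply: big1 => g _; rewrite ffunE mulr0.
under eq_bigr => g _ do rewrite sum_ffunE mulr_sumr.
rewrite exchange_big /= (bigD1 i) //= [X in _ + X]big1 => [|j ji].
  rewrite addr0.
  under eq_bigr => g _ do rewrite ffunE mulrCA.
  rewrite -mulr_sumr pairing eqxx mul1r => /eqP.
  by rewrite mulf_eq0 (negPf G0) orbF => /eqP.
under eq_bigr => g _ do rewrite ffunE mulrCA.
by rewrite -mulr_sumr pairing (negPf ji) mul0r mulr0.
Qed.

(** In the basis of the v(m), the matrix of g is monomial; only the m fixed by
    g contribute to its diagonal. *)
Lemma cluster_charE l (g : unitri F n) :
  cluster_char theta l g =
  \sum_(m <- undup [seq coact h l | h : unitri F n] | coact g m == m)
     theta (m (nil_sub1 g)).
Proof.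
set s := undup _.
have us : uniq s by exact: undup_uniq.
pose X := map_tuple (@cluster_vec F C n theta) (in_tuple s).
have fX : free X by exact: cluster_vec_free.
have bX : basis_of (cluster_module theta l) X.
  rewrite /basis_of fX andbT; apply/eqP; apply: eq_span => v /=.
  apply/mapP/mapP => [[m]|[h hin ->]].
    by rewrite mem_undup => /mapP[h hin ->] ->; exists h.
  by exists (coact h l) => //; rewrite mem_undup; apply: image_f.
have -> : cluster_char theta l g =
    \sum_i coord (vbasis (cluster_module theta l)) i
       (reg_act g (vbasis (cluster_module theta l))`_i).
  by rewrite /cluster_char /mxtrace; apply: eq_bigr => i _; rewrite mxE.
rewrite (trace_basis_indep (vbasisP _) bX) => [|v]; last first.
  exact: cluster_module_stable.
rewrite [in RHS]big_mkcond (big_nth 0) big_mkord; apply: eq_bigr => i _.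
have sP (m : nilalg_dual F n) : m \in s -> coact g m \in s.
  rewrite !mem_undup => /mapP[h _ ->]; rewrite -coactM.
  by apply: image_f.
rewrite [X`_i]/= (nth_map 0) //= reg_act_vec linearZ /=.
have gs : coact g s`_i \in s by apply: sP; exact: mem_nth.
have js : (seq.index (coact g s`_i)%R s < size s)%N by rewrite index_mem.
have -> : cluster_vec theta (coact g s`_i) = X`_(Ordinal js).
  by rewrite /= (nth_map 0) // nth_index.
rewrite coord_free //.
have -> : (Ordinal js == i) = (coact g s`_i == s`_i).
  by rewrite -val_eqE /= -(nth_uniq 0 js (ltn_ord i) us) nth_index.
by case: ifP => _; rewrite ?mulr1 ?mulr0.
Qed.

End CharacterFormula.

(** * The coadjoint action in coordinates *)

Lemma mxtrace_mul_delta (R : pzRingType) (n : nat) (A : 'M[R]_n) (i j : 'I_n) :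
  \tr (A *m delta_mx j i) = A i j.
Proof.
rewrite /mxtrace (bigD1 i) //= big1 => [|k ki]; rewrite !mxE.
  rewrite addr0 (bigD1 j) //= big1 => [|k kj]; rewrite !mxE.
    by rewrite !eqxx mulr1 addr0.
  by rewrite (negPf kj) mulr0.
by rewrite big1 // => b _; rewrite !mxE (negPf ki) andbF mulr0.
Qed.

Section Coordinates.
Variables (F : finFieldType) (n : nat).
Implicit Types (l : nilalg_dual F n) (g : unitri F n) (M T : 'M[F]_n).

Definition coords l : 'M[F]_n :=
  \matrix_(i, j) if (i < j)%N then l (nil_unit F i j) else 0.

(** The action of g on coordinates, see [coords_coact]; the truncation reflects
    that a linear form is only evaluated on strictly upper triangular
    matrices. *)
Definition coact_mx g M : 'M[F]_n :=
  \matrix_(i, j) if (i < j)%N then (M *m (umx g)^T) i j else 0.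

Definition coorbit T : {set 'M[F]_n} := [set coact_mx h T | h : unitri F n].

Lemma coordsE l X : l X = \tr (coords l *m (vsval X)^T).
Proof.
have XE : X = \sum_i \sum_j vsval X i j *: nil_unit F i j.
  apply: val_inj; rewrite /= linear_sum [LHS]matrix_sum_delta.
  apply: eq_bigr => i _; rewrite linear_sum; apply: eq_bigr => j _.
  rewrite linearZ /=; case: (ltnP i j) => [ij|ji]; first by rewrite val_nil_unit.
  by have /nilvsP X0 := subvsP X; rewrite X0 // !scale0r.
rewrite {1}XE linear_sum; apply: eq_bigr => i _; rewrite linear_sum mxE.
apply: eq_bigr => j _; rewrite linearZ /= !mxE mulrC.
case: ifP => [//|/negbT]; rewrite -leqNgt => ji.
by have /nilvsP X0 := subvsP X; rewrite X0 // scale0r mul0r.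
Qed.

Lemma coords_inj : injective coords.
Proof. by move=> l m e; apply/lfunP => X; rewrite !coordsE e. Qed.

Lemma coords_coact g l : coords (coact g l) = coact_mx g (coords l).
Proof.
apply/matrixP => i j; rewrite !mxE; case: ifP => // ij.
rewrite coactE coordsE val_nil_mulr val_nil_unit // trmx_mul trmx_delta mulmxA.
by rewrite mxtrace_mul_delta mxE.
Qed.

Lemma coact_mx_sum (I : finType) (P : pred I) (f : I -> 'M[F]_n) g :
  coact_mx g (\sum_(p | P p) f p) = \sum_(p | P p) coact_mx g (f p).
Proof.
apply/matrixP => i j; rewrite summxE mxE mulmx_suml summxE.
case: ifP => ij; last by rewrite big1 // => p _; rewrite mxE ij.
by apply: eq_bigr => p _; rewrite [RHS]mxE ij.
Qed.

End Coordinates.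

(** The fixed point sum rewritten over a finite type of matrices, where products
    of sums can be distributed. *)
Lemma cluster_char_coords (F : finFieldType) (C : numFieldType) (n : nat)
    (theta : addchar F C) (l : nilalg_dual F n) (g : unitri F n) :
  nontrivial theta ->
  cluster_char theta l g =
  \sum_(M in coorbit (coords l) | coact_mx g M == M)
     theta (\tr (M *m (umx g - 1%:M)^T)).
Proof.
move=> theta_nt; rewrite cluster_charE //; set s := undup _.
transitivity (\sum_(M <- [seq coords m | m <- s] | coact_mx g M == M)
    theta (\tr (M *m (umx g - 1%:M)^T))).
  rewrite big_map; apply: eq_big => m.
    by rewrite -coords_coact (inj_eq (@coords_inj F n)).
  by rewrite coordsE val_nil_sub1.
rewrite big_mkcond big_uniq /=; last first.
  by rewrite (map_inj_uniq (@coords_inj F n)) undup_uniq.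
rewrite -big_mkcondr; apply: eq_bigl => M; congr (_ && _).
apply/mapP/imsetP => [[m]|[h _ ->]].
  by rewrite mem_undup => /mapP[h _ ->] ->; exists h; rewrite ?coords_coact.
exists (coact h l); last by rewrite coords_coact.
by rewrite mem_undup; apply: image_f.
Qed.

(** * Orbits of templates *)

Section Orbits.
Variables (F : finFieldType) (n : nat).
Implicit Types (g : unitri F n) (M T : 'M[F]_n).

Definition template_mx T :=
  [/\ forall i j : 'I_n, (j <= i)%N -> T i j = 0,
      forall i j k, T i j != 0 -> T i k != 0 -> j = k
    & forall i j k, T i k != 0 -> T j k != 0 -> i = j].

Definition free_pos T (i j : 'I_n) :=
  (i < j)%N && [exists k : 'I_n, (j < k)%N && (T i k != 0)].

(** Acting by h, the entry in position (i, j) of T becomes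
    sum_(k >= j) h_jk T_ik.  If T_ik is the only nonzero entry of row i, this is
    h_jk T_ik for j < k, and T_ij for j >= k since h is unitriangular.
    Conversely a matrix h with h_jk = M_ij / T_ik is well defined because T has
    at most one nonzero entry T_ik in column k. *)
Lemma coorbit_template T M : template_mx T ->
  (M \in coorbit T) = [forall i, forall j, free_pos T i j || (M i j == T i j)].
Proof.
move=> [T0 Trow Tcol]; apply/imsetP/forallP => [[h _ ->] i|MT].
  apply/forallP => j; case: (boolP (free_pos T i j)) => //= nfree.
  rewrite !mxE; case: ltnP => [ij|ji]; last by rewrite T0.
  have /unitriangularP[h0 h1] := umxP h.
  rewrite (bigD1 j) //= mxE h1 mulr1 big1 ?addr0 // => k kj; rewrite mxE.
  have [kltj|jltk|/val_inj e] := ltngtP k j; last by rewrite e eqxx in kj.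
    by rewrite h0 ?mulr0.
  move: nfree; rewrite /free_pos ij => /existsPn/(_ k).
  by rewrite jltk negbK => /eqP->; rewrite mul0r.
(* Since 0^-1 = 0, the sum has at most one nonzero term: the row i of the
   nonzero entry of column k, if there is one. *)
pose A : 'M[F]_n := \matrix_(j < n, k < n)
  ((j == k)%:R + if (j < k)%N then \sum_(i < n | (i < j)%N) M i j / T i k else 0).
have uA : unitriangular A.
  apply/unitriangularP; split=> [i j ji|i]; rewrite mxE.
    by rewrite ltnNge (ltnW ji) addr0; case: eqP ji => // ->; rewrite ltnn.
  by rewrite eqxx ltnn addr0.
exists (UniTri uA) => //; apply/matrixP => i j; rewrite mxE.
have /forallP/(_ j) := MT i; rewrite /free_pos.
case: ltnP => [ij|ji] /=; last by rewrite T0 // => /eqP.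
rewrite mxE.
case: (boolP [exists k : 'I_n, _]) => [/existsP[k /andP[jk Tik]] _|nfree /= /eqP->].
  rewrite (bigD1 k) //= big1 => [|k' k'k].
    rewrite addr0 !mxE jk.
    have -> : (j == k) = false by apply/eqP => e; rewrite e ltnn in jk.
    rewrite add0r (bigD1 i) //= big1 => [|i' /andP[_ i'i]].
      by rewrite addr0 mulrC mulfVK.
    case: (eqVneq (T i' k) 0) => [->|Ti'k]; first by rewrite invr0 mulr0.
    by rewrite (Tcol _ _ _ Ti'k Tik) eqxx in i'i.
  case: (eqVneq (T i k') 0) => [->|Tik']; first by rewrite mul0r.
  by rewrite (Trow _ _ _ Tik' Tik) eqxx in k'k.
rewrite (bigD1 j) //= big1 => [|k kj]; first by rewrite !mxE eqxx ltnn !addr0 mulr1.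
rewrite !mxE eq_sym (negPf kj) add0r; case: ltnP => [jk|_]; last by rewrite mulr0.
by have /existsPn/(_ k) := nfree; rewrite jk negbK => /eqP->; rewrite mul0r.
Qed.

Definition unit_part T (p : 'I_n * 'I_n) : 'M[F]_n :=
  T p.1 p.2 *: delta_mx p.1 p.2.

Lemma unit_partE T p i j :
  unit_part T p i j = if (i == p.1) && (j == p.2) then T i j else 0.
Proof.
rewrite !mxE; case: eqP => [->|_]; last by rewrite mulr0.
by case: eqP => [->|_]; rewrite ?mulr1 ?mulr0.
Qed.

Lemma unit_part_template T p : template_mx T -> template_mx (unit_part T p).
Proof.
move=> [T0 Trow Tcol]; split=> [i j ji|i j k|i j k]; rewrite !unit_partE.
- by rewrite T0 // if_same.
- case: ifP => [/andP[_ /eqP->] _|_]; last by rewrite eqxx.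
  by case: ifP => [/andP[_ /eqP->]|]; rewrite ?eqxx.
- case: ifP => [/andP[/eqP-> _] _|_]; last by rewrite eqxx.
  by case: ifP => [/andP[/eqP-> _]|]; rewrite ?eqxx.
Qed.

Lemma sum_unit_part T : template_mx T ->
  \sum_(p : 'I_n * 'I_n | (p.1 < p.2)%N) unit_part T p = T.
Proof.
move=> [T0 _ _]; apply/matrixP => i j; rewrite summxE.
under eq_bigr => p _ do rewrite unit_partE.
case: (ltnP i j) => [ij|ji].
  rewrite (bigD1 (i, j)) //= !eqxx big1 ?addr0 // => -[a b] /= /andP[_ nab].
  by case: ifP => // /andP[/eqP ai /eqP bj]; rewrite ai bj eqxx in nab.
by rewrite big1 ?T0 // => p _; rewrite if_same.
Qed.

Lemma free_pos_unit_part T p i j :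
  free_pos (unit_part T p) i j = [&& (i < j)%N, i == p.1, (j < p.2)%N & T p.1 p.2 != 0].
Proof.
rewrite /free_pos; case: ltnP => //= ij; apply/existsP/and3P => [[k]|[/eqP-> jp Tp]].
  by rewrite unit_partE; case: ifP => [/andP[/eqP-> /eqP->] /andP[-> ->]|]; rewrite ?eqxx ?andbF.
by exists p.2; rewrite unit_partE !eqxx jp.
Qed.

End Orbits.

(** * Splitting the orbit of a template into rows *)

Section Decomposition.
Variables (F : finFieldType) (n : nat) (T : 'M[F]_n).
Hypothesis T_templ : template_mx T.
Implicit Types (g : unitri F n) (M : 'M[F]_n) (p : 'I_n * 'I_n).

Let P p := (p.1 < p.2)%N.

(** The component at a nonzero entry p of T is the row of M through p.  All other
    components vanish, as the orbit of the corresponding part of T is the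
    singleton 0. *)
Definition row_split M : {ffun 'I_n * 'I_n -> 'M[F]_n} :=
  [ffun p => \matrix_(i, j) if (T p.1 p.2 != 0) && (i == p.1) then M i j else 0].

Lemma coorbit_unit_partP p M :
  reflect (forall i j, ~~ free_pos (unit_part T p) i j -> M i j = unit_part T p i j)
          (M \in coorbit (unit_part T p)).
Proof.
rewrite coorbit_template; last exact: unit_part_template.
apply: (iffP forallP) => [MT i j nf|MT i].
  by have /forallP/(_ j) := MT i; rewrite (negPf nf) => /eqP.
by apply/forallP => j; case: (boolP (free_pos _ _ _)) => //= /MT->.
Qed.

(** Positions free for a part of T are free for T, and at the other positions
    the parts add up to T. *)
Lemma coorbit_sum (f : 'I_n * 'I_n -> 'M[F]_n) :
  (forall p, P p -> f p \in coorbit (unit_part T p)) ->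
  \sum_(p | P p) f p \in coorbit T.
Proof.
move=> fT; rewrite coorbit_template //; apply/forallP => i; apply/forallP => j.
case: (boolP (free_pos T i j)) => //= nf; apply/eqP.
rewrite -[in RHS](sum_unit_part T_templ) !summxE; apply: eq_bigr => p /fT.
move/coorbit_unit_partP; apply; rewrite free_pos_unit_part.
apply: contra nf => /and4P[ij /eqP ip jp]; rewrite -ip /free_pos ij => Tp.
by apply/existsP; exists p.2; rewrite jp.
Qed.

Lemma row_split_coorbit M p :
  M \in coorbit T -> row_split M p \in coorbit (unit_part T p).
Proof.
rewrite coorbit_template // => /forallP MT; apply/coorbit_unit_partP => i j.
have [T0 Trow _] := T_templ.
rewrite free_pos_unit_part ffunE mxE unit_partE.
have [Tp|Tp] /= := eqVneq (T p.1 p.2) 0.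
  by case: ifP => // /andP[/eqP-> /eqP->].
case: (eqVneq i p.1) => [ip|//] /=; rewrite andbT -ip in Tp * => nf.
have /forallP/(_ j)/orP[|/eqP->] := MT i; last first.
  case: eqP => // jp; apply/eqP/negPn/negP => Tij.
  by case: jp; exact: Trow Tij Tp.
case/andP => ij /existsP[k /andP[jk Tik]].
by rewrite (Trow _ _ _ Tik Tp) in jk; rewrite ij jk in nf.
Qed.

(** Each row of M is a component, except the rows in which T vanishes; in these
    M vanishes too. *)
Lemma row_splitK M :
  M \in coorbit T -> \sum_(p | P p) row_split M p = M.
Proof.
rewrite coorbit_template // => /forallP MT; apply/matrixP => i j.
have [T0 Trow _] := T_templ.
rewrite summxE; under eq_bigr => p _ do rewrite ffunE mxE.
case: (pickP (fun k => T i k != 0)) => [k Tik|Ti0].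
  have ik : (i < k)%N.
    by rewrite ltnNge; apply: contra Tik => /T0->.
  rewrite (bigD1 (i, k)) //= Tik eqxx big1 ?addr0 // => -[a b] /= /andP[_ nab].
  case: ifP => // /andP[Tab /eqP ia]; rewrite -ia in Tab nab.
  by rewrite (Trow _ _ _ Tab Tik) eqxx in nab.
rewrite big1 => [|p _].
  have /forallP/(_ j)/orP[/andP[_ /existsP[k]]|/eqP->] := MT i.
    by rewrite Ti0 andbF.
  by apply/esym/eqP/negPn; rewrite Ti0.
by case: ifP => // /andP[Tp /eqP ip]; rewrite -ip Ti0 in Tp.
Qed.

(** The orbit of a one-entry part of T lies in the row of that entry, and
    distinct nonzero entries of T are in distinct rows: no two components
    overlap. *)
Lemma row_split_sum (f : {ffun 'I_n * 'I_n -> 'M[F]_n}) :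
  (forall p, P p -> f p \in coorbit (unit_part T p)) ->
  (forall p, ~~ P p -> f p = 0) ->
  row_split (\sum_(p | P p) f p) = f.
Proof.
move=> fT f0; apply/ffunP => p; apply/matrixP => i j; rewrite ffunE mxE summxE.
have [T0 Trow _] := T_templ.
have fE q : ~~ ((T q.1 q.2 != 0) && (i == q.1)) -> f q i j = 0.
  case: (boolP (P q)) => [/fT/coorbit_unit_partP fq nq|/f0-> _]; last by rewrite mxE.
  rewrite fq ?free_pos_unit_part.
    rewrite unit_partE; case: ifP => // /andP[/eqP iq /eqP jq].
    by apply/eqP; move: nq; rewrite iq jq eqxx andbT negbK.
  by apply: contra nq => /and4P[_ -> _ ->].
case: ifP => [/andP[Tp /eqP ip]|/negbT/fE->//].
have Pp : P p by rewrite /P ltnNge; apply: contra Tp => /T0->.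
rewrite (bigD1 p) //= big1 ?addr0 // => q /andP[_ qp]; apply: fE.
apply: contra qp => /andP[Tq /eqP iq]; move: p q Tp Tq ip iq {Pp}.
move=> [a b] [c d] /= Tab Tcd ia ic; subst a c.
by rewrite (Trow _ _ _ Tab Tcd).
Qed.

Lemma coact_row_split g M p :
  coact_mx g (row_split M p) = row_split (coact_mx g M) p.
Proof.
apply/matrixP => i j; rewrite !ffunE !mxE.
case: ifP => ij; last by rewrite if_same.
case: ifP => ip; last by apply: big1 => k _; rewrite mxE ip mul0r.
by apply: eq_bigr => k _; rewrite mxE ip.
Qed.

End Decomposition.

(** * The factorization *)

Lemma coords_template (F : finFieldType) (n : nat) (l : nilalg_dual F n) :
  coadjoint_template l -> template_mx (coords l).
Proof.
move=> [lrow lcol].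
have suppE i j : (coords l i j != 0) = ((i, j) \in supp l).
  by rewrite mxE inE /=; case: ifP => //; rewrite eqxx.
split=> [i j ji|i j k|i j k]; rewrite ?suppE.
- by rewrite mxE ltnNge ji.
- move=> ij ik; have /card_le1_eqP e := lrow i.
  by have [] // : (i, j) = (i, k) by apply: e; rewrite inE /= ?ij ?ik eqxx.
- move=> ik jk; have /card_le1_eqP e := lcol k.
  by have [] // : (i, k) = (j, k) by apply: e; rewrite inE /= ?ik ?jk eqxx.
Qed.

Lemma coords_unit_part (F : finFieldType) (n : nat) (l : nilalg_dual F n)
    (p : 'I_n * 'I_n) :
  (p.1 < p.2)%N ->
  coords (l (nil_unit F p.1 p.2) *: dual_unit F p.1 p.2) = unit_part (coords l) p.
Proof.
move=> pP; apply/matrixP => i j; rewrite unit_partE !mxE.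
case: ifP => ij; last by rewrite if_same.
rewrite scale_lfunE dual_unitE val_nil_unit // mxE ![_ == p.1]eq_sym ![_ == p.2]eq_sym.
case: eqP => [<-|_] /=; last by rewrite scaler0.
by case: eqP => [<-|_] /=; rewrite ?scaler0 // [_ *: _]mulr1.
Qed.

Theorem theorem6p1 (R : realType) (F : finFieldType) (n : nat) (n_ge1 : (1 <= n)%N)
    (theta : addchar F R[i]) (theta_nontrivial : nontrivial theta)
    (tau : nilalg_dual F n) (tau_template : coadjoint_template tau) :
  forall g : unitri F n,
    cluster_char theta tau g =
    \prod_(p : 'I_n * 'I_n | (p.1 < p.2)%N)
      cluster_char theta (tau (nil_unit F p.1 p.2) *: dual_unit F p.1 p.2) g.
Proof.
move=> g; have T_templ := coords_template tau_template.
set T := coords tau in T_templ.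
have addchar_sum (f : 'I_n * 'I_n -> F) :
    theta (\sum_(p : 'I_n * 'I_n | (p.1 < p.2)%N) f p)
      = \prod_(p : 'I_n * 'I_n | (p.1 < p.2)%N) theta (f p).
  exact: (big_morph _ (addcharD theta) (addchar1 theta)).
rewrite cluster_char_coords // -/T.
transitivity (\prod_(p : 'I_n * 'I_n | (p.1 < p.2)%N)
    \sum_(M in coorbit (unit_part T p) | coact_mx g M == M)
      theta (\tr (M *m (umx g - 1%:M)^T))); last first.
  apply: eq_bigr => p pP.
  by rewrite -(coords_unit_part tau pP) -cluster_char_coords.
(* Families are padded with the zero matrix outside the positions p.1 < p.2, as
   [row_split] is there. *)
rewrite (big_distr_big_dep 0) /=.
rewrite (reindex_onto (row_split T) (fun f : {ffun _ -> _} =>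
   \sum_(p : 'I_n * 'I_n | (p.1 < p.2)%N) f p)) /=; last first.
  move=> f /pfamilyP[fsupp fT]; apply: row_split_sum => // [p /fT /andP[]//|p np].
  by apply/eqP; apply: contraNT np => fp; apply: (subsetP fsupp).
apply: eq_big => [M|M /andP[MT _]]; last first.
  by rewrite -addchar_sum -raddf_sum -mulmx_suml row_splitK.
(* A matrix recovered from its rows, each fixed and in the orbit of its part, is
   itself fixed and in the orbit of T, and conversely. *)
apply/andP/andP => [[MT /eqP gM]|[/pfamilyP[_ splitT] /eqP MK]].
  split; last by rewrite row_splitK.
  apply/pfamilyP; split=> [|p _]; last first.
    apply/andP; split; first exact: row_split_coorbit.
    by rewrite coact_row_split gM.
  apply/subsetP => p; rewrite !inE; apply: contraNT => np.
  have {}np : (p.1 < p.2)%N = false by exact: negPf np.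
  by apply/eqP/matrixP => i j; rewrite ffunE !mxE np eqxx.
have fixT (p : 'I_n * 'I_n) : (p.1 < p.2)%N -> row_split T M p \in coorbit (unit_part T p)
    /\ coact_mx g (row_split T M p) = row_split T M p.
  by move=> /splitT /andP[-> /eqP->].
rewrite -MK; split; first by apply: coorbit_sum => // p /fixT[].
by rewrite coact_mx_sum; apply/eqP/eq_bigr => p /fixT[].
Qed.
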